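(* There exist absolute constants $c,d>0$ such that the following holds for every finite-precision Lanczos run of $k$ completed iterations (for arbitrary $n$, symmetric $A\in\mathbb{R}^{n\times n}$, nonzero $v\in\mathbb{R}^n$, $k_{\max}$, $k\le k_{\max}$ and $0\le\varepsilon\le 1/(20k_{\max})$, as defined in the context). Every eigenvalue $\theta$ of $T_k$ satisfies $$\operatorname{dist}\bigl(\theta,[\lambda_{\min}(A),\lambda_{\max}(A)]\bigr)\le c\,k^d\,\varepsilon\|A\|.$$
   Context: Norms are Euclidean for vectors and spectral for matrices; $\lambda_{\min}(A),\lambda_{\max}(A)$ are the extreme eigenvalues of $A$; $\operatorname{dist}$ is the distance from a real number to a subset of $\mathbb{R}$. Finite-precision Lanczos run. Let $n,k_{\max}\ge1$ be integers, $A\in\mathbb{R}^{n\times n}$ symmetric, $v\in\mathbb{R}^n$ nonzero, and let the accuracy parameter satisfy $0\le\varepsilon\le 1/(20k_{\max})$. A run of $k$ completed iterations ($1\le k\le k_{\max}$) of the finite-precision symmetric Lanczos algorithm without reorthogonalization on $(A,v)$ consists of real vectors $v_j,u_j,w_j,z_j\in\mathbb{R}^n$ and real scalars $\alpha_j,\beta_j$ such that: $v_0=0$, $\beta_0=0$; $v_1$ satisfies $|v_1^{\mathsf T}v_1-1|\le\varepsilon$ and $\beta v_1=v+\Delta_0$ for some $\beta>0$ and some $\Delta_0$ with $\|\Delta_0\|\le\varepsilon\|v\|$; and for $j=1,\dots,k$ there are errors with $$u_j=Av_j+e^u_j,\quad \|e^u_j\|\le\varepsilon\|A\|\|v_j\|;$$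 $$w_j=u_j-\beta_{j-1}v_{j-1}+e^w_j,\quad \|e^w_j\|\le\varepsilon(\|u_j\|+\beta_{j-1}\|v_{j-1}\|);$$ $$\alpha_j=v_j^{\mathsf T}w_j+e^\alpha_j,\quad |e^\alpha_j|\le\varepsilon\|v_j\|\|w_j\|;$$ $$z_j=w_j-\alpha_jv_j+e^z_j,\quad \|e^z_j\|\le\varepsilon(\|w_j\|+|\alpha_j|\|v_j\|).$$ If $z_j\ne0$ then $\beta_j>0$, $\beta_jv_{j+1}=z_j+\Delta_j$ with $\|\Delta_j\|\le\varepsilon\|z_j\|$, and $|v_{j+1}^{\mathsf T}v_{j+1}-1|\le\varepsilon$. If $z_j=0$ then $\beta_j=0$ and the algorithm terminates. Termination can occur only at $j=k$, so $\beta_1,\dots,\beta_{k-1}>0$. If the run terminates at step $k$, $v_{k+1}$ is not formed and by convention $\Delta_k=0$ and $\beta_kv_{k+1}=0$. $T_k\in\mathbb{R}^{k\times k}$ is the symmetric tridiagonal matrix with diagonal $\alpha_1,\dots,\alpha_k$ and off-diagonal entries $\beta_1,\dots,\beta_{k-1}$. *)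

(* Defs.v *)
From HB Require Import structures.
From mathcomp Require Import all_boot all_order all_algebra.
From mathcomp Require Import all_classical all_reals all_analysis.

Set Implicit Arguments.
Unset Strict Implicit.
Unset Printing Implicit Defensive.

Import Order.TTheory GRing.Theory Num.Theory.
Import numFieldNormedType.Exports.

Local Open Scope classical_set_scope.
Local Open Scope ring_scope.

Definition dotv (R : realType) n (x y : 'cV[R]_n) : R := (x^T *m y) 0 0.

(* The norm that MathComp-Analysis puts on matrices is the max norm, hence
   these definitions. *)
Definition enorm (R : realType) n (x : 'cV[R]_n) : R :=
  Num.sqrt (\sum_(i < n) x i 0 ^+ 2).

Definition spectral_norm (R : realType) m n (A : 'M[R]_(m, n)) : R :=
  sup [set enorm (A *m x) | x in [set x : 'cV[R]_n | enorm x <= 1]].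

(* The set of real eigenvalues is finite, and nonempty when A is symmetric of
   positive size, so inf and sup are then its least and greatest elements. *)
Definition lambda_min (R : realType) n (A : 'M[R]_n) : R :=
  inf [set a : R | eigenvalue A a].

Definition lambda_max (R : realType) n (A : 'M[R]_n) : R :=
  sup [set a : R | eigenvalue A a].

(* Ordinal indices start at 0, whereas alpha and beta are indexed from 1 on
   the diagonal and off-diagonal of T_k. *)
Definition tridiag (R : realType) (k : nat) (alpha beta : nat -> R) : 'M[R]_k :=
  \matrix_(i < k, j < k)
    if i == j :> nat then alpha i.+1
    else if j == i.+1 :> nat then beta i.+1
    else if i == j.+1 :> nat then beta j.+1
    else 0.

(* k completed iterations of finite-precision Lanczos on (A, b), b being the
   starting vector.  The families are total functions on nat of which only the
   indices 0 <= j <= k (and k+1 for v when z k != 0) are constrained.  When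
   z k = 0 we have beta k = 0, so that beta k *: v k.+1 = 0 and v k.+1 is
   immaterial. *)
Record lanczos_run (R : realType) (n : nat) (A : 'M[R]_n) (b : 'cV[R]_n)
    (eps : R) (k : nat) (v u w z : nat -> 'cV[R]_n) (alpha beta : nat -> R)
    : Prop := LanczosRun {
  run_v0 : v 0%N = 0;
  run_beta0 : beta 0%N = 0;
  run_v1_unit : `|dotv (v 1%N) (v 1%N) - 1| <= eps;
  run_v1 : exists (beta_init : R) (D0 : 'cV[R]_n),
    [/\ 0 < beta_init, beta_init *: v 1%N = b + D0 &
        enorm D0 <= eps * enorm b];
  run_u : forall j, (1 <= j <= k)%N -> exists2 e : 'cV[R]_n,
    u j = A *m v j + e & enorm e <= eps * spectral_norm A * enorm (v j);
  run_w : forall j, (1 <= j <= k)%N -> exists2 e : 'cV[R]_n,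
    w j = u j - beta j.-1 *: v j.-1 + e &
    enorm e <= eps * (enorm (u j) + beta j.-1 * enorm (v j.-1));
  run_alpha : forall j, (1 <= j <= k)%N -> exists2 e : R,
    alpha j = dotv (v j) (w j) + e &
    `|e| <= eps * enorm (v j) * enorm (w j);
  run_z : forall j, (1 <= j <= k)%N -> exists2 e : 'cV[R]_n,
    z j = w j - alpha j *: v j + e &
    enorm e <= eps * (enorm (w j) + `|alpha j| * enorm (v j));
  run_next : forall j, (1 <= j <= k)%N -> z j != 0 ->
    [/\ 0 < beta j,
        exists2 D : 'cV[R]_n, beta j *: v j.+1 = z j + D &
                              enorm D <= eps * enorm (z j) &
        `|dotv (v j.+1) (v j.+1) - 1| <= eps];
  run_stop : forall j, (1 <= j <= k)%N -> z j = 0 -> beta j = 0;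
  run_no_early_stop : forall j, (1 <= j < k)%N -> z j != 0
}.

(* Main.v *)
(* Paige's argument.  Let T_t be the leading t x t part of T_k, V_t the matrix of
   the computed vectors v_1, ..., v_t, and R the strictly upper triangular part of
   V_t^T V_t.  The recurrence and the symmetry of A give
   T_t R - R T_t = beta_t V_t^T v_(t+1) e_t^T + F with small entries of F.
   Let T_t y = theta y with |y| = 1.
   - If z = V_t y is not short, then y^T (T_t R - R T_t) y = 0 makes
     beta_t y_t z^T v_(t+1) small, so that theta is close to the Rayleigh quotient
     of A at z.
   - Since |z|^2 is close to 1 + 2 y^T R y, z can only be short if y^T R y is not
     small.  But y^T R y = sum_s y_(s+1)^2 tr (F_s (T_s - theta)^-1), so some T_s
     with s < t has an eigenvalue close to theta, and induction on t applies.
   The scalars alpha_j, beta_j are only shown to be O(k |A|), from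
   beta_j <= (1 + 12 eps) (|A| + beta_(j-1)), which costs powers of k. *)
Require Import Defs.
From HB Require Import structures.
From mathcomp Require Import all_boot all_order all_algebra.
From mathcomp Require Import all_classical all_reals all_analysis.
From mathcomp Require Import spectral complex.
From mathcomp Require Import ring lra zify.

Set Implicit Arguments.
Unset Strict Implicit.
Unset Printing Implicit Defensive.

Import Order.TTheory GRing.Theory Num.Theory.
Import numFieldNormedType.Exports.

Local Open Scope classical_set_scope.
Local Open Scope ring_scope.

(** * Euclidean inner product and norm *)

Lemma dotvE (R : realType) n (x y : 'cV[R]_n) :
  dotv x y = \sum_(i < n) x i 0 * y i 0.
Proof. by rewrite /dotv mxE; apply: eq_bigr => i _; rewrite mxE. Qed.

Lemma dotvC (R : realType) n (x y : 'cV[R]_n) : dotv x y = dotv y x.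
Proof. by rewrite !dotvE; apply: eq_bigr => i _; rewrite mulrC. Qed.

Lemma dotvDl (R : realType) n (x y t : 'cV[R]_n) :
  dotv (x + y) t = dotv x t + dotv y t.
Proof. by rewrite /dotv linearD mulmxDl mxE. Qed.

Lemma dotvDr (R : realType) n (x y t : 'cV[R]_n) :
  dotv t (x + y) = dotv t x + dotv t y.
Proof. by rewrite /dotv mulmxDr mxE. Qed.

Lemma dotvNr (R : realType) n (x t : 'cV[R]_n) : dotv t (- x) = - dotv t x.
Proof. by rewrite /dotv mulmxN mxE. Qed.

Lemma dotvNl (R : realType) n (x t : 'cV[R]_n) : dotv (- x) t = - dotv x t.
Proof. by rewrite dotvC dotvNr dotvC. Qed.

Lemma dotvZl (R : realType) n (a : R) (x t : 'cV[R]_n) :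
  dotv (a *: x) t = a * dotv x t.
Proof. by rewrite /dotv linearZ -scalemxAl mxE. Qed.

Lemma dotvZr (R : realType) n (a : R) (x t : 'cV[R]_n) :
  dotv t (a *: x) = a * dotv t x.
Proof. by rewrite /dotv -scalemxAr mxE. Qed.

Lemma dotv0l (R : realType) n (t : 'cV[R]_n) : dotv 0 t = 0.
Proof. by rewrite /dotv trmx0 mul0mx mxE. Qed.

Lemma dotv0r (R : realType) n (t : 'cV[R]_n) : dotv t 0 = 0.
Proof. by rewrite dotvC dotv0l. Qed.

Lemma dotv_suml (R : realType) n (I : finType) (F : I -> 'cV[R]_n) t :
  dotv (\sum_i F i) t = \sum_i dotv (F i) t.
Proof.
by elim/big_rec2: _ => [|i y1 y2 _ <-]; rewrite ?dotv0l ?dotvDl.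
Qed.

Lemma dotv_sumr (R : realType) n (I : finType) (F : I -> 'cV[R]_n) t :
  dotv t (\sum_i F i) = \sum_i dotv t (F i).
Proof. by rewrite dotvC dotv_suml; apply: eq_bigr => i _; rewrite dotvC. Qed.

Lemma dotv_mulmx_sym (R : realType) n (A : 'M[R]_n) (x y : 'cV[R]_n) :
  A^T = A -> dotv x (A *m y) = dotv (A *m x) y.
Proof. by move=> symA; rewrite /dotv trmx_mul symA mulmxA. Qed.

Lemma dotv_ge0 (R : realType) n (x : 'cV[R]_n) : 0 <= dotv x x.
Proof. by rewrite dotvE sumr_ge0 // => i _; rewrite -expr2 sqr_ge0. Qed.

Lemma enorm_ge0 (R : realType) n (x : 'cV[R]_n) : 0 <= enorm x.
Proof. exact: sqrtr_ge0. Qed.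

Lemma enorm_sqr (R : realType) n (x : 'cV[R]_n) : enorm x ^+ 2 = dotv x x.
Proof.
rewrite sqr_sqrtr ?dotvE; first by apply: eq_bigr => i _; rewrite expr2.
by rewrite sumr_ge0 // => i _; rewrite sqr_ge0.
Qed.

Lemma dotv_eq0 (R : realType) n (x : 'cV[R]_n) : (dotv x x == 0) = (x == 0).
Proof.
apply/eqP/eqP => [|->]; last exact: dotv0l.
rewrite dotvE => /eqP; rewrite psumr_eq0; last first.
  by move=> i _; rewrite -expr2 sqr_ge0.
move=> /allP x0; apply/colP => i; rewrite mxE.
by have := x0 i (mem_index_enum _); rewrite -expr2 sqrf_eq0 => /eqP.
Qed.

Lemma coord_sqr_le_dotv (R : realType) n (x : 'cV[R]_n) i :
  x i 0 ^+ 2 <= dotv x x.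
Proof.
rewrite dotvE (bigD1 i) //= -expr2 lerDl sumr_ge0 // => j _.
by rewrite -expr2 sqr_ge0.
Qed.

(** Cauchy-Schwarz: the squared length of |y|^2 x - (x,y) y is |y|^2 (|x|^2 |y|^2 - (x,y)^2), and
    the case y = 0 is treated apart. *)
Lemma dotv_le_enorm (R : realType) n (x y : 'cV[R]_n) :
  `|dotv x y| <= enorm x * enorm y.
Proof.
rewrite -ler_sqr ?nnegrE ?normr_ge0 ?mulr_ge0 ?enorm_ge0 //.
rewrite exprMn !enorm_sqr -normrX ger0_norm ?sqr_ge0 //.
have := dotv_ge0 (dotv y y *: x - dotv x y *: y).
rewrite !(dotvDl, dotvDr, dotvNl, dotvNr, dotvZl, dotvZr) (dotvC y x).
have := dotv_ge0 y; rewrite le_eqVlt => /orP[/eqP yy0|yy_gt0].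
  have /eqP -> : y == 0 by rewrite -dotv_eq0 -yy0.
  by rewrite !(dotv0l, dotv0r) expr0n /= ?(mulr0, mul0r, lexx).
set a := dotv x y; set b := dotv y y; set c := dotv x x => H.
have {}H : 0 <= b * (c * b - a ^+ 2) by move: H; congr (_ <= _); ring.
by rewrite -subr_ge0; rewrite pmulr_rge0 in H.
Qed.

Lemma enormD (R : realType) n (x y : 'cV[R]_n) :
  enorm (x + y) <= enorm x + enorm y.
Proof.
rewrite -ler_sqr ?nnegrE ?addr_ge0 ?enorm_ge0 // sqrrD !enorm_sqr.
rewrite !(dotvDl, dotvDr) (dotvC y x).
have := le_trans (ler_norm _) (dotv_le_enorm x y).
rewrite mulr2n; lra.
Qed.

Lemma enormZ (R : realType) n a (x : 'cV[R]_n) : enorm (a *: x) = `|a| * enorm x.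
Proof.
apply/eqP; rewrite -(@eqrXn2 _ 2) ?mulr_ge0 ?enorm_ge0 //.
by rewrite exprMn !enorm_sqr dotvZl dotvZr mulrA -expr2 real_normK ?num_real.
Qed.

Lemma enormN (R : realType) n (x : 'cV[R]_n) : enorm (- x) = enorm x.
Proof. by rewrite -scaleN1r enormZ normrN1 mul1r. Qed.

Lemma enorm0 (R : realType) n : enorm (0 : 'cV[R]_n) = 0.
Proof. by rewrite -(scale0r 0) enormZ normr0 mul0r. Qed.

Lemma enorm_eq0 (R : realType) n (x : 'cV[R]_n) : (enorm x == 0) = (x == 0).
Proof. by rewrite -sqrf_eq0 enorm_sqr dotv_eq0. Qed.

(** * Spectral norm *)

(** The crude bound by the sum of the column norms serves only to show that the supremum defining
    [spectral_norm] is taken over a bounded set. *)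
Lemma enorm_mulmx_bounded (R : realType) m n (A : 'M[R]_(m, n)) :
  exists M, forall x : 'cV[R]_n, enorm (A *m x) <= M * enorm x.
Proof.
exists (\sum_j enorm (col j A)) => x.
have -> : A *m x = \sum_j x j 0 *: col j A.
  apply/colP => i; rewrite mxE summxE.
  by apply: eq_bigr => j _; rewrite !mxE mulrC.
apply: (@le_trans _ _ (\sum_j enorm (x j 0 *: col j A))).
  apply: (big_ind2 (fun (u : 'cV[R]_m) t => enorm u <= t)) => //.
    by rewrite enorm0.
  by move=> u1 t1 u2 t2 h1 h2; apply: le_trans (enormD _ _) _; rewrite lerD.
rewrite mulr_suml ler_sum // => j _; rewrite enormZ mulrC ler_wpM2l ?enorm_ge0 //.
rewrite -ler_sqr ?nnegrE ?enorm_ge0 // real_normK ?num_real // enorm_sqr.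
exact: coord_sqr_le_dotv.
Qed.

Lemma enorm_mulmx_le (R : realType) m n (A : 'M[R]_(m, n)) (x : 'cV[R]_n) :
  enorm (A *m x) <= spectral_norm A * enorm x.
Proof.
have [M leM] := enorm_mulmx_bounded A.
have bnd : has_ubound [set enorm (A *m y) | y in [set y | enorm y <= 1]].
  exists `|M| => _ [y /= y1 <-]; apply: le_trans (leM y) _.
  apply: le_trans (ler_wpM2r (enorm_ge0 _) (ler_norm M)) _.
  by rewrite ler_piMr.
have [->|x0] := eqVneq x 0; first by rewrite mulmx0 !enorm0 mulr0.
have x_gt0 : 0 < enorm x by rewrite lt_def enorm_eq0 x0 enorm_ge0.
rewrite -ler_pdivrMr //.
have -> : enorm (A *m x) / enorm x = enorm (A *m ((enorm x)^-1 *: x)).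
  by rewrite -scalemxAr enormZ ger0_norm ?invr_ge0 ?enorm_ge0 // mulrC.
apply: ub_le_sup => //; exists ((enorm x)^-1 *: x) => //=.
by rewrite enormZ ger0_norm ?invr_ge0 ?enorm_ge0 // mulVf ?gt_eqF.
Qed.

Lemma spectral_norm_ge0 (R : realType) m n (A : 'M[R]_(m, n)) :
  0 <= spectral_norm A.
Proof.
have [M leM] := enorm_mulmx_bounded A.
apply: (@le_trans _ _ (enorm (A *m 0))); first exact: enorm_ge0.
apply: ub_le_sup; last by exists 0 => //=; rewrite enorm0.
exists `|M| => _ [y /= y1 <-]; apply: le_trans (leM y) _.
apply: le_trans (ler_wpM2r (enorm_ge0 _) (ler_norm M)) _.
by rewrite ler_piMr.
Qed.

(** * Diagonalization, Rayleigh quotients and resolvents of symmetric matrices *)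

(** The spectral theorem is applied over [R[i]], where A is Hermitian. The eigenvectors it gives may
    be complex, but the squared moduli [p i] of the coordinates of x are real and determine all
    three quadratic forms, so no real eigenbasis has to be built. *)
Lemma symmetric_diagonalization (R : realType) (n : nat) (A : 'M[R]_n) :
  A^T = A ->
  exists2 d : 'I_n -> R, forall i, eigenvalue A (d i) &
    forall x : 'cV[R]_n, exists p : 'I_n -> R,
      [/\ forall i, 0 <= p i, dotv x x = \sum_i p i,
          dotv x (A *m x) = \sum_i d i * p i &
          dotv (A *m x) (A *m x) = \sum_i d i ^+ 2 * p i].
Proof.
move=> symA; pose toC m p := @map_mx R R[i] (real_complex R) m p.
have toC_real m p (M : 'M[R]_(m, p)) i j : toC _ _ M i j \is Num.real.
  by rewrite mxE complex_real.
have symAC : toC _ _ A \is hermsymmx.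
  apply: realsym_hermsym; last by apply/mxOverP => i j; exact: toC_real.
  apply/is_hermitianmxP; rewrite expr0 scale1r map_mx_id //.
  by apply/matrixP => i j; rewrite !mxE -{1}symA mxE.
have DE := orthomx_spectralP (hermitian_normalmx symAC).
have PU := spectral_unitarymx (toC _ _ A).
have Dreal := hermitian_spectral_diag_real symAC.
move: DE PU Dreal.
set P := spectralmx _; set D := spectral_diag _ => DE PU Dreal.
have Punit := unitarymx_unit PU.
pose d i := complex.Re (D 0 i).
have dE i : (d i)%:C%C = D 0 i by rewrite RRe_real // (mxOverP Dreal).
have PA : P *m toC _ _ A = diag_mx D *m P.
  by rewrite [in LHS]DE -!mulmxA mulKVmx.
have row_nz i : row i P != 0.
  apply/eqP => Pi0.
  have : row i (P *m invmx P) = 0 by rewrite row_mul Pi0 mul0mx.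
  rewrite mulmxV // => /rowP/(_ i); rewrite !mxE eqxx => /eqP.
  by rewrite oner_eq0.
(* Parseval's identity for the unitary P; applied to x and A x it yields the three sums at the
   end. *)
have parseval (x y : 'cV[R]_n) : (dotv x y)%:C%C =
    \sum_i ((P *m toC _ _ x) i 0)^* * (P *m toC _ _ y) i 0.
  have -> : (dotv x y)%:C%C = ((toC _ _ x)^T *m toC _ _ y) 0 0.
    by rewrite /toC map_trmx -map_mxM mxE.
  have -> : (toC _ _ x)^T = (map_mx Num.conj (toC _ _ x)^T).
    apply/matrixP => i j; rewrite [RHS]mxE (CrealP _) //.
    by rewrite mxE toC_real.
  have PP : map_mx Num.conj P^T *m P = 1%:M by rewrite -invmx_unitary // mulVmx.
  rewrite -{1}[toC _ _ y]mul1mx -PP !mulmxA -mulmxA -map_mxM -trmx_mul mxE.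
  by apply: eq_bigr => i _; congr (_ * _); rewrite !mxE.
exists d => [i|x].
  rewrite -(eigenvalue_map (real_complex R)); apply/eigenvalueP.
  exists (row i P); last exact: row_nz.
  have -> : map_mx (real_complex R) A = toC n n A by [].
  rewrite -row_mul PA; apply/rowP => j.
  rewrite !mxE (bigD1 i) //= big1 ?addr0; last first.
    by move=> l li; rewrite !mxE eq_sym (negbTE li) mul0r.
  by rewrite [diag_mx D i i]mxE eqxx dE.
pose q i := (P *m toC _ _ x) i 0.
pose p i := complex.Re (q i) ^+ 2 + complex.Im (q i) ^+ 2.
have pE i : (p i)%:C%C = (q i)^* * q i.
  by rewrite add_Re2_Im2 normCK mulrC.
have qA i : (P *m toC _ _ (A *m x)) i 0 = (d i)%:C%C * q i.
  rewrite /toC map_mxM mulmxA PA -mulmxA mxE (bigD1 i) //= big1 ?addr0; last first.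
    by move=> l li; rewrite !mxE eq_sym (negbTE li) mul0r.
  by rewrite [diag_mx D i i]mxE eqxx dE.
have inj : injective (fun t : R => t%:C%C) by exact: complexI.
exists p; split.
- by move=> i; rewrite addr_ge0 ?sqr_ge0.
- apply: inj => /=; rewrite parseval rmorph_sum.
  by apply: eq_bigr => i _ /=; rewrite pE.
- apply: inj => /=; rewrite parseval rmorph_sum.
  by apply: eq_bigr => i _; rewrite qA [in RHS]rmorphM /= pE mulrCA.
- apply: inj => /=; rewrite parseval rmorph_sum.
  apply: eq_bigr => i _; rewrite qA [in RHS]rmorphM /= rmorphM /= pE.
  rewrite (CrealP _) ?complex_real // expr2 rmorphM /=.
  rewrite -!mulrA; congr (_ * _); exact: mulrCA.
Qed.

(** Needed to compare the supremum and infimum in [lambda_max] and [lambda_min] with individual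
    eigenvalues. *)
Lemma symmetric_eigenvalues_bounded (R : realType) (n : nat) (A : 'M[R]_n) :
  A^T = A -> exists M, forall a, eigenvalue A a -> `|a| <= M.
Proof.
move=> symA; have [d _ dP] := symmetric_diagonalization symA.
exists (\sum_i `|d i|) => a /eigenvalueP[y yA y0].
have [p [p0 sp Ap _]] := dP y^T.
have yy_gt0 : 0 < dotv y^T y^T.
  by rewrite lt_def dotv_ge0 dotv_eq0 trmx_eq0 y0.
move: Ap; rewrite -[in A *m _]symA -trmx_mul yA linearZ dotvZr => Ap.
rewrite -(ler_pM2r yy_gt0) -[X in _ * X <= _](ger0_norm (ltW yy_gt0)) -normrM Ap.
apply: le_trans (ler_norm_sum _ _ _) _.
rewrite sp mulr_suml ler_sum // => i _.
rewrite normrM (ger0_norm (p0 i)) ler_wpM2l //.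
by rewrite (bigD1 i) //= lerDl sumr_ge0.
Qed.

Lemma eigenvalue_le_lambda_max (R : realType) (n : nat) (A : 'M[R]_n) a :
  A^T = A -> eigenvalue A a -> a <= lambda_max A.
Proof.
move=> /symmetric_eigenvalues_bounded[M leM] Aa.
apply: ub_le_sup => //; exists M => x /leM; exact: le_trans (ler_norm _).
Qed.

Lemma lambda_min_le_eigenvalue (R : realType) (n : nat) (A : 'M[R]_n) a :
  A^T = A -> eigenvalue A a -> lambda_min A <= a.
Proof.
move=> /symmetric_eigenvalues_bounded[M leM] Aa.
by apply: ge_inf => //; exists (- M) => x /leM; rewrite ler_norml => /andP[].
Qed.

Lemma rayleigh_le_lambda_max (R : realType) (n : nat) (A : 'M[R]_n) x :
  A^T = A -> dotv x (A *m x) <= lambda_max A * dotv x x.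
Proof.
move=> symA; have [d dA dP] := symmetric_diagonalization symA.
have [p [p0 -> -> _]] := dP x; rewrite mulr_sumr ler_sum // => i _.
by rewrite ler_wpM2r // eigenvalue_le_lambda_max.
Qed.

Lemma lambda_min_le_rayleigh (R : realType) (n : nat) (A : 'M[R]_n) x :
  A^T = A -> lambda_min A * dotv x x <= dotv x (A *m x).
Proof.
move=> symA; have [d dA dP] := symmetric_diagonalization symA.
have [p [p0 -> -> _]] := dP x; rewrite mulr_sumr ler_sum // => i _.
by rewrite ler_wpM2r // lambda_min_le_eigenvalue.
Qed.

Lemma lambda_min_le_max (R : realType) (n : nat) (A : 'M[R]_n) :
  A^T = A -> (0 < n)%N -> lambda_min A <= lambda_max A.
Proof.
move=> symA n0; have [d dA _] := symmetric_diagonalization symA.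
have Ad := dA (Ordinal n0).
exact: le_trans (lambda_min_le_eigenvalue symA Ad) (eigenvalue_le_lambda_max symA Ad).
Qed.

(** In an eigenbasis the right-hand side is the sum of (th - d_i)^2 p_i, and each squared gap is at
    least q^2. *)
Lemma symmetric_shift_lower_bound (R : realType) (n : nat) (T : 'M[R]_n) (th q : R) :
  T^T = T -> 0 <= q -> (forall a, eigenvalue T a -> q <= `|th - a|) ->
  forall x, q ^+ 2 * dotv x x <= dotv ((T - th%:M) *m x) ((T - th%:M) *m x).
Proof.
move=> symT q0 sepT x; have [d dT dP] := symmetric_diagonalization symT.
have [p [p0 pxx pTx pTT]] := dP x.
rewrite mulmxBl mul_scalar_mx !(dotvDl, dotvDr, dotvNl, dotvNr, dotvZl, dotvZr).
rewrite (dotvC (T *m x) x) pxx pTx pTT.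
have -> : \sum_i d i ^+ 2 * p i - th * (\sum_i d i * p i)
    + (- (th * (\sum_i d i * p i)) - - (th * (th * (\sum_i p i))))
    = \sum_i (th - d i) ^+ 2 * p i.
  rewrite opprK !mulr_sumr -!sumrN -!big_split /=.
  by apply: eq_bigr => i _; ring.
rewrite mulr_sumr ler_sum // => i _; rewrite ler_wpM2r //.
by rewrite -[leRHS]real_normK ?num_real // ler_sqr ?nnegrE // sepT.
Qed.

(** T - th maps column j of its inverse to the unit vector e_j, so the lower bound for the shift
    limits the length of that column. The product form covers q = 0. *)
Lemma symmetric_resolvent_bound (R : realType) (n : nat) (T : 'M[R]_n) (th q : R) :
  T^T = T -> 0 <= q -> (forall a, eigenvalue T a -> q <= `|th - a|) ->
  (T - th%:M) \in unitmx ->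
  forall i j, q * `|invmx (T - th%:M) i j| <= 1.
Proof.
move=> symT q0 sepT uS i j; set G := invmx _.
have := symmetric_shift_lower_bound symT q0 sepT (col j G).
have -> : (T - th%:M) *m col j G = delta_mx j 0.
  by rewrite colE mulmxA mulmxV // mul1mx.
have -> : dotv (delta_mx j 0) (delta_mx j 0 : 'cV[R]_n) = 1.
  rewrite dotvE (bigD1 j) //= big1 => [|l lj]; rewrite !mxE ?eqxx ?mulr1 ?addr0 //.
  by rewrite (negbTE lj) mul0r.
move=> H; rewrite -ler_sqr ?nnegrE ?mulr_ge0 // expr1n exprMn real_normK ?num_real //.
apply: le_trans H; rewrite ler_wpM2l ?sqr_ge0 //.
by have := coord_sqr_le_dotv (col j G) i; rewrite mxE.
Qed.

Lemma not_eigenvalue_unitmx (F : fieldType) (n : nat) (T : 'M[F]_n) th :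
  ~~ eigenvalue T th -> (T - th%:M) \in unitmx.
Proof.
move=> nT; rewrite -row_free_unit -kermx_eq0; apply/negPn/negP => K0.
by move: nT; rewrite /eigenvalue /eigenspace K0.
Qed.

(* tr ((S Rm - Rm S) S^-1) = 0, hence tr (E S^-1) = - e^T S^-1 r. *)
Lemma trace_commutator_resolvent (F : fieldType) (n : nat)
    (S Rm E : 'M[F]_n) (r e x : 'cV[F]_n) (c : F) :
  S^T = S -> S \in unitmx ->
  S *m Rm - Rm *m S = r *m e^T + E -> S *m x = - (c *: e) ->
  (r^T *m x) 0 0 = c * \tr (E *m invmx S).
Proof.
move=> symS uS comm Sx; pose G := invmx S.
have -> : E = S *m Rm - Rm *m S - r *m e^T by rewrite comm addrC addKr.
rewrite !mulmxBl !raddfB /= mxtrace_mulC mulmxA mulVmx // mul1mx.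
rewrite -mulmxA mulmxV // mulmx1 subrr sub0r -mulmxA mxtrace_mulC.
have -> : x = - c *: (G *m e).
  by rewrite scaleNr scalemxAr -mulmxN -Sx mulKmx.
have symG : G^T = G by rewrite /G trmx_inv symS.
rewrite -scalemxAr mxE mulNr mulrN; congr (- (c * _)).
have tr00 (M : 'M[F]_1) : M 0 0 = M^T 0 0 by rewrite mxE.
by rewrite /mxtrace big_ord1 [LHS]tr00 !trmx_mul trmxK symG.
Qed.

(** * Tridiagonal matrices and three-term recurrences *)

Lemma sum_ord_pred1 (V : nmodType) t m (h : nat -> V) :
  \sum_(l < t) (if l == m :> nat then h l else 0) = if (m < t)%N then h m else 0.
Proof.
case: ifPn => [mt|mt].
  rewrite (bigD1 (Ordinal mt)) //= eqxx big1 ?addr0 // => l.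
  by rewrite -val_eqE /= => /negbTE ->.
rewrite big1 // => l _; case: eqP => // lm.
by move: mt; rewrite -lm ltn_ord.
Qed.

Lemma tridiag_sym (R : realType) t (al be : nat -> R) :
  (tridiag t al be)^T = tridiag t al be.
Proof.
apply/matrixP => i j; rewrite !mxE eq_sym; case: eqP => [->//|_].
by case: eqP => ij; case: eqP => ji //; lia.
Qed.

(** Sequences are indexed from 1 as in T_t. The convention [be 0 = 0] absorbs the missing left
    neighbour in the first row; the missing right neighbour in the last row is the [if]. *)
Lemma tridiag_row_sum (R : realType) t (al be f : nat -> R) (i : 'I_t) :
  be 0%N = 0 ->
  \sum_(l < t) tridiag t al be i l * f l.+1 =
  be i * f i + al i.+1 * f i.+1 + (if (i.+1 < t)%N then be i.+1 * f i.+2 else 0).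
Proof.
move=> be0.
have -> : be i * f i = \sum_(l < t) (if l.+1 == i :> nat then be l.+1 * f l.+1 else 0).
  have [i0|i0] := posnP i.
    by rewrite i0 be0 mul0r big1 // => l _; rewrite i0.
  rewrite (eq_bigr (fun l : 'I_t => if l == i.-1 :> nat then be l.+1 * f l.+1 else 0)).
    rewrite (sum_ord_pred1 _ _ (fun l => be l.+1 * f l.+1)) prednK //.
    by rewrite (ltnW (ltn_ord i)).
  by move=> l _; rewrite -[in LHS](prednK i0) eqSS.
have -> : al i.+1 * f i.+1 =
    \sum_(l < t) (if l == i :> nat then al i.+1 * f l.+1 else 0).
  by rewrite (sum_ord_pred1 _ _ (fun l => al i.+1 * f l.+1)) ltn_ord.
rewrite -(sum_ord_pred1 _ _ (fun l => be i.+1 * f l.+1)) -!big_split /=.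
apply: eq_bigr => l _; rewrite !mxE.
case: (eqVneq (i : nat) l) => [<-|il].
  by rewrite (gtn_eqF (ltnSn _)) (ltn_eqF (ltnSn _)) add0r addr0.
case: (eqVneq (l : nat) i.+1) => [->|li].
  by rewrite gtn_eqF ?add0r.
by rewrite !addr0 eq_sym; case: eqP => _; rewrite ?mul0r.
Qed.

(** Extending the eigenvector by y_(t+1) = 0 makes the three-term recurrence hold in every row, the
    last one included. *)
Lemma tridiag_eigenvector (R : realType) t (al be : nat -> R) th :
  be 0%N = 0 -> eigenvalue (tridiag t al be) th ->
  exists y : nat -> R,
    [/\ y t.+1 = 0, 0 < \sum_(i < t) y i.+1 ^+ 2 &
     forall i, (i < t)%N ->
       be i * y i + al i.+1 * y i.+1 + be i.+1 * y i.+2 = th * y i.+1].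
Proof.
move=> be0 /eigenvalueP[w wT w0].
(* The index is shifted by one; the default 0 outside the range supplies y_(t+1) = 0. *)
pose y i := if i is l.+1 then oapp (w 0) 0 (insub l : option 'I_t) else 0.
have yS (i : 'I_t) : y i.+1 = w 0 i by rewrite /= valK.
have yt : y t.+1 = 0 by rewrite /= insubF ?ltnn.
clearbody y; exists y; split=> // [|i it].
  rewrite lt_def sumr_ge0 ?andbT; last by move=> i _; rewrite sqr_ge0.
  apply: contraNneq w0 => /eqP; rewrite psumr_eq0; last by move=> i _; rewrite sqr_ge0.
  move=> /allP y0; apply/eqP/rowP => i; rewrite mxE -yS.
  by have := y0 i (mem_index_enum _); rewrite sqrf_eq0 => /eqP.
have := congr1 (fun M : 'rV_t => M 0 (Ordinal it)) wT.
rewrite !mxE -yS => <-.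
rewrite (eq_bigr (fun l : 'I_t => tridiag t al be (Ordinal it) l * y l.+1)).
  rewrite tridiag_row_sum //=; case: ifPn => // ti.
  by have -> : i.+1 = t; [apply/eqP; rewrite eqn_leq it leqNgt|rewrite yt mulr0].
(* [eigenvalue] provides a row vector, turned into a column equation by the symmetry of T_t. *)
by move=> l _; rewrite mulrC yS -[in LHS]tridiag_sym mxE.
Qed.

Lemma sum_square_split (R : comPzRingType) t (h : nat -> nat -> R) :
  (forall i j, h i j = h j i) ->
  \sum_(i < t) \sum_(j < t) h i j =
  \sum_(i < t) h i i + 2 * \sum_(s < t) \sum_(i < s) h i s.
Proof.
move=> hC; elim: t => [|t IH]; first by rewrite !big_ord0 mulr0 addr0.
rewrite big_ord_recr /= (eq_bigr (fun i : 'I_t => \sum_(j < t) h i j + h i t)).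
  rewrite big_split /= IH !big_ord_recr /=.
  have -> : \sum_(i < t) h t i = \sum_(i < t) h i t by apply: eq_bigr.
  ring.
by move=> i _; rewrite big_ord_recr.
Qed.

(** Summation by parts: the two sums differ by telescoping terms in the discrete Wronskian be_i (y_i
    c_(i+1) - y_(i+1) c_i), which vanishes at i = 0. *)
Lemma tridiag_green_identity (R : comPzRingType) (al be y c : nat -> R) t :
  be 0%N = 0 ->
  \sum_(i < t) y i.+1 * (be i * c i + al i.+1 * c i.+1 + be i.+1 * c i.+2) =
  \sum_(i < t) (be i * y i + al i.+1 * y i.+1 + be i.+1 * y i.+2) * c i.+1
  + be t * (y t * c t.+1 - y t.+1 * c t).
Proof.
move=> be0; elim: t => [|t IH]; first by rewrite !big_ord0 be0 mul0r addr0.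
by rewrite !big_ord_recr /= IH; ring.
Qed.

Lemma sum_mul_le_sum_sqr (R : realType) t (y : nat -> R) (M : 'I_t -> 'I_t -> R) (C : R) :
  0 <= C -> (forall i j, `|M i j| <= C) ->
  `|\sum_(i < t) \sum_(j < t) y i.+1 * y j.+1 * M i j|
    <= t%:R ^+ 2 * C * \sum_(i < t) y i.+1 ^+ 2.
Proof.
move=> C0 MC; set N := (X in _ <= _ * X).
have yN (i : 'I_t) : y i.+1 ^+ 2 <= N.
  by rewrite /N (bigD1 i) //= lerDl sumr_ge0 // => l _; rewrite sqr_ge0.
apply: (@le_trans _ _ (\sum_(i < t) \sum_(j < t) (C * N))); last first.
  rewrite !sumr_const !card_ord -(mulr_natl (C * N *+ t)) -(mulr_natl (C * N)).
  by rewrite expr2 -!mulrA.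
apply: le_trans (ler_norm_sum _ _ _) _; apply: ler_sum => i _.
apply: le_trans (ler_norm_sum _ _ _) _; apply: ler_sum => j _.
(* Each |y_i y_j| is at most (y_i^2 + y_j^2) / 2, hence at most N. *)
rewrite normrM mulrC ler_pM // normrM.
have := yN i; have := yN j; rewrite -[y i.+1 ^+ 2]real_normK ?num_real //.
rewrite -[y j.+1 ^+ 2]real_normK ?num_real //.
have := sqr_ge0 (`|y i.+1| - `|y j.+1|); lra.
Qed.

(** * Perturbed Lanczos recurrences: commutator and eigenvalue bounds *)

(* [E] bounds the entries of F; the fractions are what that bound leaves to each
   error term. *)
Record perturbed_lanczos (R : realType) (n k : nat) (A : 'M[R]_n)
    (v f : nat -> 'cV[R]_n) (al be : nat -> R) (E : R) : Prop :=
  PerturbedLanczos {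
  pl_be0 : be 0%N = 0;
  pl_rec : forall j, (j < k)%N ->
    A *m v j.+1 = be j *: v j + al j.+1 *: v j.+1 + be j.+1 *: v j.+2 + f j.+1;
  pl_norm : forall j, (j < k)%N -> 9 / 10 <= dotv (v j.+1) (v j.+1);
  pl_err : forall i j, (i < k)%N -> (j < k)%N ->
    `|dotv (v i.+1) (f j.+1)| <= 2 / 5 * E;
  pl_local : forall j, (j <= k)%N -> `|be j * dotv (v j) (v j.+1)| <= E / 2;
  pl_normB : forall j, (j.+1 < k)%N ->
    `|be j.+1 * (dotv (v j.+2) (v j.+2) - dotv (v j.+1) (v j.+1))| <= E / 5
}.

(** A function on [nat] rather than a matrix, so that its truncations give the matrix R for every
    T_t at once. *)
Definition gram_upper (R : realType) (n : nat) (v : nat -> 'cV[R]_n) (i j : nat) : R :=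
  if (i < j)%N then dotv (v i) (v j) else 0.

(* Row i.+1, column j.+1 of T g - g T, with g taken as infinite: in the last column
   of a finite T_t it also contains the term in g i.+1 t.+1, i.e. the rank-one
   matrix of the next lemma. *)
Definition tridiag_commutator (R : realType) (al be : nat -> R)
    (g : nat -> nat -> R) (i j : nat) : R :=
  be i * g i j.+1 + al i.+1 * g i.+1 j.+1 + be i.+1 * g i.+2 j.+1
  - (be j * g i.+1 j + al j.+1 * g i.+1 j.+1 + be j.+1 * g i.+1 j.+2).

Lemma tridiag_commutatorE (R : realType) (t : nat) (al be : nat -> R)
    (g : nat -> nat -> R) :
  be 0%N = 0 -> (forall i j, (j <= i)%N -> g i j = 0) ->
  tridiag t al be *m (\matrix_(i < t, j < t) g i.+1 j.+1)
  - (\matrix_(i < t, j < t) g i.+1 j.+1) *m tridiag t al be =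
  (\col_(i < t) g i.+1 t.+1) *m (\col_(i < t) (if i.+1 == t then be t else 0))^T
  + \matrix_(i < t, j < t) tridiag_commutator al be g i j.
Proof.
move=> be0 g0; apply/matrixP => i j; rewrite !mxE big_ord1 !mxE.
rewrite (eq_bigr (fun l : 'I_t => tridiag t al be i l * g l.+1 j.+1)); last first.
  by move=> l _; rewrite !mxE.
rewrite (tridiag_row_sum al (fun l => g l j.+1)) //.
rewrite [X in _ - X = _](eq_bigr
  (fun l : 'I_t => tridiag t al be j l * g i.+1 l.+1)); last first.
  by move=> l _; rewrite -[in LHS]tridiag_sym !mxE mulrC.
rewrite (tridiag_row_sum al (fun l => g i.+1 l)) // /tridiag_commutator.
(* Below the last row of the truncation nothing is lost: g is strictly upper triangular, so
   [g t.+1 j.+1] is 0. *)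
have -> : (if (i.+1 < t)%N then be i.+1 * g i.+2 j.+1 else 0) = be i.+1 * g i.+2 j.+1.
  by case: ltnP => // ti; rewrite g0 ?mulr0 // (leq_trans (ltn_ord j)) // ltnW.
case: (ltnP j.+1 t) => jt; first by rewrite ltn_eqF // mulr0 add0r.
have -> : j.+1 = t by apply/eqP; rewrite eqn_leq jt ltn_ord.
by rewrite eqxx; ring.
Qed.

(** Above the diagonal, v_i^T A v_j is expanded by the recurrence at j and, by symmetry of A, at i;
    the difference leaves two error terms of size 2/5 E. On the superdiagonal, the squared lengths
    absent from R add at most E/5. On the diagonal two local terms of size E/2 remain, and below it
    every term is 0. *)
Lemma perturbed_lanczos_commutator_le (R : realType) (n k : nat) (A : 'M[R]_n)
    (v f : nat -> 'cV[R]_n) (al be : nat -> R) (E : R) i j :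
  A^T = A -> perturbed_lanczos k A v f al be E -> (i < k)%N -> (j < k)%N ->
  `|tridiag_commutator al be (gram_upper v) i j| <= E.
Proof.
move=> symA [be0 rec _ err loc nrmB] ik jk.
have E0 : 0 <= E by have := le_trans (normr_ge0 _) (loc _ (leq0n k)); lra.
have vAv : dotv (v i.+1) (A *m v j.+1) = dotv (v j.+1) (A *m v i.+1).
  by rewrite dotv_mulmx_sym // dotvC.
move: vAv; rewrite !rec // !dotvDr !dotvZr => vAv.
have /ler_normlP[e1 e2] := err _ _ ik jk.
have /ler_normlP[e3 e4] := err _ _ jk ik.
rewrite /tridiag_commutator /gram_upper ler_norml.
case: (ltngtP i j) => ij.
- have -> : (i < j.+1)%N by lia.
  have -> : (i.+1 < j.+1)%N by lia.
  have -> : (i.+1 < j.+2)%N by lia.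
  case: (ltngtP i.+1 j) => ij1; last 1 first.
  + have -> : (i.+2 < j.+1)%N = false by lia.
    have k1 : (i.+1 < k)%N by lia.
    have /ler_normlP[] := nrmB _ k1.
    move: vAv; rewrite -ij1 (dotvC (v i.+2) (v i.+1)) (dotvC (v i.+2) (v i)).
    move: e1 e2 e3 e4; rewrite -ij1 => *; apply/andP; split; lra.
  + have -> : (i.+2 < j.+1)%N by lia.
    move: vAv; rewrite (dotvC (v j.+1) (v i.+1)) (dotvC (v j.+1) (v i)).
    rewrite (dotvC (v j.+1) (v i.+2)) => *; apply/andP; split; lra.
  + by move: ij1; lia.
- have -> : (i < j.+1)%N = false by lia.
  have -> : (i.+1 < j.+1)%N = false by lia.
  have -> : (i.+2 < j.+1)%N = false by lia.
  have -> : (i.+1 < j)%N = false by lia.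
  have -> : (i.+1 < j.+2)%N = false by lia.
  by apply/andP; split; lra.
- rewrite -ij ltnSn ltnSn !ltnn ltnNge leqnSn /= ltnNge leqnSn /=.
  have /ler_normlP[] := loc _ (ltnW ik); have /ler_normlP[] := loc _ ik.
  by move=> *; apply/andP; split; lra.
Qed.

(** The trace has s^2 <= k^2 products of entries, each at most 1 / (8 k^2); this fixes the
    separation 8 k^2 E. *)
Lemma trace_mul_resolvent_le (R : realType) (s k : nat) (T F : 'M[R]_s) (th E : R) :
  (s <= k)%N -> (0 < k)%N -> T^T = T -> 0 <= E -> (forall i j, `|F i j| <= E) ->
  (forall a, eigenvalue T a -> 8 * k%:R ^+ 2 * E <= `|th - a|) ->
  (T - th%:M) \in unitmx ->
  `|\tr (F *m invmx (T - th%:M))| <= 1 / 8.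
Proof.
move=> sk k0 symT E0 FE sepT uS; set G := invmx _.
have k2 : 0 < 8 * k%:R ^+ 2 :> R by rewrite mulr_gt0 ?exprn_gt0 ?ltr0n.
have Q0 : 0 <= 8 * k%:R ^+ 2 * E by rewrite mulr_ge0 // ltW.
(* E may be 0, so the entries of G are bounded only after multiplication by E. *)
have EG i j : E * `|G i j| <= (8 * k%:R ^+ 2)^-1.
  rewrite -(ler_pM2l k2) mulfV ?gt_eqF // mulrA.
  exact: (symmetric_resolvent_bound symT Q0 sepT uS).
apply: (@le_trans _ _ (\sum_(i < s) \sum_(j < s) (8 * k%:R ^+ 2)^-1)).
  apply: le_trans (ler_norm_sum _ _ _) _; apply: ler_sum => i _; rewrite mxE.
  apply: le_trans (ler_norm_sum _ _ _) _; apply: ler_sum => j _.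
  by rewrite normrM; apply: le_trans (EG j i); rewrite ler_wpM2r.
set C := (_)^-1; rewrite !sumr_const !card_ord -(mulr_natl (C *+ s)) -(mulr_natl C).
rewrite mulrA /C ler_pdivrMr // mulrA mul1r mulVf ?mul1r ?pnatr_eq0 //.
by rewrite expr2 ler_pM // ler_nat.
Qed.

(* With the resolvent of T_s, the factor be s, which may be tiny, cancels from the
   part of y^T R y that lies in column s + 1. *)
Lemma gram_column_le (R : realType) (n k : nat) (A : 'M[R]_n)
    (v f : nat -> 'cV[R]_n) (al be y : nat -> R) (E th : R) s :
  A^T = A -> perturbed_lanczos k A v f al be E -> (s < k)%N ->
  (forall a, eigenvalue (tridiag s al be) a -> 8 * k%:R ^+ 2 * E < `|th - a|) ->
  (forall i, (i < s)%N ->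
     be i * y i + al i.+1 * y i.+1 + be i.+1 * y i.+2 = th * y i.+1) ->
  `|\sum_(i < s) y i.+1 * y s.+1 * dotv (v i.+1) (v s.+1)| <= 1 / 8 * y s.+1 ^+ 2.
Proof.
move=> symA pl sk sepT recy; have be0 := pl_be0 pl.
have E0 : 0 <= E by have := le_trans (normr_ge0 _) (pl_local pl (leq0n k)); lra.
have Q0 : 0 <= 8 * k%:R ^+ 2 * E by rewrite !mulr_ge0 // ?sqr_ge0.
set T := tridiag s al be in sepT *.
have symT : T^T = T by exact: tridiag_sym.
(* The separation is strict, so th itself is not an eigenvalue of T_s. *)
have uS : (T - th%:M) \in unitmx.
  apply: not_eigenvalue_unitmx; apply/negP => /sepT.
  by rewrite subrr normr0 ltNge Q0.
have g0 i j : (j <= i)%N -> gram_upper v i j = 0.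
  by rewrite /gram_upper leqNgt => /negbTE ->.
have comm := tridiag_commutatorE s al be0 g0.
move: comm; rewrite -/T; set Rm := (X in _ *m X - _).
set r := (X in _ = X *m _ + _); set e := (X in _ = _ *m X^T + _).
set F := (X in _ = _ + X) => comm.
have FE i j : `|F i j| <= E.
  by rewrite mxE (perturbed_lanczos_commutator_le symA pl) // (ltn_trans (ltn_ord _)).
have commS : (T - th%:M) *m Rm - Rm *m (T - th%:M) = r *m e^T + F.
  by rewrite -comm mulmxBl mulmxBr scalar_mxC opprB addrA subrK.
pose x := \col_(i < s) y i.+1.
(* Cutting y after s entries violates the eigenvector equation in the last row only, by the lost
   term be_s y_(s+1). *)
have Sx : (T - th%:M) *m x = - (y s.+1 *: e).
  rewrite mulmxBl mul_scalar_mx; apply/colP => i; rewrite !mxE.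
  rewrite (eq_bigr (fun l : 'I_s => T i l * y l.+1)); last by move=> l _; rewrite !mxE.
  rewrite tridiag_row_sum // -recy //.
  case: (ltnP i.+1 s) => js; first by rewrite ltn_eqF // mulr0 oppr0; ring.
  have -> : i.+1 = s by apply/eqP; rewrite eqn_leq js ltn_ord.
  by rewrite eqxx; ring.
have symS : (T - th%:M)^T = T - th%:M by rewrite linearB /= symT tr_scalar_mx.
have := trace_commutator_resolvent symS uS commS Sx.
rewrite mxE => rx.
have -> : \sum_(i < s) y i.+1 * y s.+1 * dotv (v i.+1) (v s.+1)
    = y s.+1 ^+ 2 * \tr (F *m invmx (T - th%:M)).
  rewrite expr2 -mulrA -rx mulr_sumr; apply: eq_bigr => i _.
  by rewrite !mxE /gram_upper ltnS ltn_ord; ring.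
rewrite normrM (ger0_norm (sqr_ge0 _)) mulrC ler_wpM2r ?sqr_ge0 //.
have k0 : (0 < k)%N by exact: leq_ltn_trans sk.
apply: (trace_mul_resolvent_le (ltnW sk) k0 symT E0 FE) => // a aT.
exact/ltW/sepT.
Qed.

(** With N = |y|^2, the vector z = V_t y has |z|^2 >= N/2, and z^T A z differs from th |z|^2 by at
    most (1 + 2/5) t^2 E N <= 14/5 k^2 E |z|^2, which is within the allowed 8 k^2 E |z|^2. *)
Lemma perturbed_lanczos_rayleigh (R : realType) (n k : nat) (A : 'M[R]_n)
    (v f : nat -> 'cV[R]_n) (al be : nat -> R) (E th : R) t :
  A^T = A -> perturbed_lanczos k A v f al be E -> (t <= k)%N ->
  eigenvalue (tridiag t al be) th ->
  (forall s, (s < t)%N -> forall a, eigenvalue (tridiag s al be) a ->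
     8 * k%:R ^+ 2 * E < `|th - a|) ->
  lambda_min A - 8 * k%:R ^+ 2 * E <= th <= lambda_max A + 8 * k%:R ^+ 2 * E.
Proof.
move=> symA pl tk eT sepT; have be0 := pl_be0 pl.
have E0 : 0 <= E by have := le_trans (normr_ge0 _) (pl_local pl (leq0n k)); lra.
have [y [yt N0 recy]] := tridiag_eigenvector be0 eT.
set N := (X in 0 < X) in N0.
pose z := \sum_(i < t) y i.+1 *: v i.+1.
have zE x : dotv z x = \sum_(i < t) y i.+1 * dotv (v i.+1) x.
  by rewrite dotv_suml; apply: eq_bigr => i _; rewrite dotvZl.
(* The diagonal gives at least 9/10 N and the columns of R, counted twice, take away at most 2/8
   N. *)
have zz_ge : N / 2 <= dotv z z.
  have -> : dotv z z = \sum_(i < t) \sum_(j < t)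
      y i.+1 * y j.+1 * dotv (v i.+1) (v j.+1).
    rewrite zE; apply: eq_bigr => i _; rewrite dotv_sumr mulr_sumr.
    by apply: eq_bigr => j _; rewrite dotvZr mulrA.
  rewrite (sum_square_split _ (h := fun i j =>
    y i.+1 * y j.+1 * dotv (v i.+1) (v j.+1))); last first.
    by move=> i j; rewrite dotvC [y i.+1 * _]mulrC.
  have diag : 9 / 10 * N <= \sum_(i < t) y i.+1 * y i.+1 * dotv (v i.+1) (v i.+1).
    rewrite /N mulr_sumr ler_sum // => i _; rewrite mulrC -expr2.
    by rewrite ler_wpM2l ?sqr_ge0 // (pl_norm pl) // (leq_trans (ltn_ord i)).
  have : `|\sum_(s < t) \sum_(i < s) y i.+1 * y s.+1 * dotv (v i.+1) (v s.+1)|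
      <= 1 / 8 * N.
    apply: le_trans (ler_norm_sum _ _ _) _; rewrite /N mulr_sumr ler_sum // => s _.
    apply: (gram_column_le symA pl) => //; first exact: leq_trans (ltn_ord s) tk.
      by move=> a; apply: sepT.
    by move=> i si; apply: recy; apply: ltn_trans si (ltn_ord s).
  by move=> /ler_normlP[]; lra.
have yf : `|\sum_(i < t) y i.+1 * dotv z (f i.+1)| <= t%:R ^+ 2 * (2 / 5 * E) * N.
  rewrite (eq_bigr (fun i : 'I_t => \sum_(j < t)
    y i.+1 * y j.+1 * dotv (v j.+1) (f i.+1))); last first.
    by move=> i _; rewrite zE mulr_sumr; apply: eq_bigr => j _; rewrite mulrA.
  apply: (sum_mul_le_sum_sqr y (M := fun i j : 'I_t => dotv (v j.+1) (f i.+1))).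
    by rewrite mulr_ge0.
  by move=> i j; apply: (pl_err pl); apply: leq_trans (ltn_ord _) tk.
(* The Green identity moves T_t from the sequence z^T v_i onto y. As y_(t+1) = 0, the boundary term
   reduces to be_t y_t z^T v_(t+1). *)
have zAz : dotv z (A *m z) = th * dotv z z + be t * y t * dotv z (v t.+1)
    + \sum_(i < t) y i.+1 * dotv z (f i.+1).
  have -> : dotv z (A *m z) = \sum_(i < t) y i.+1 *
      (be i * dotv z (v i) + al i.+1 * dotv z (v i.+1) + be i.+1 * dotv z (v i.+2))
      + \sum_(i < t) y i.+1 * dotv z (f i.+1).
    rewrite -big_split /= [in A *m z]/z mulmx_sumr dotv_sumr.
    apply: eq_bigr => i _.
    rewrite -scalemxAr dotvZr (pl_rec pl) ?(leq_trans (ltn_ord i)) //.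
    by rewrite !dotvDr !dotvZr mulrDr.
  rewrite (tridiag_green_identity al y (fun i => dotv z (v i))) // yt mul0r subr0.
  rewrite (eq_bigr (fun i : 'I_t => th * (y i.+1 * dotv z (v i.+1)))); last first.
    by move=> i _; rewrite recy // mulrA.
  rewrite -mulr_sumr; congr (th * _ + _ + _); last by rewrite mulrA.
  by rewrite zE; apply: eq_bigr => i _; rewrite dotvC.
have g0 i j : (j <= i)%N -> gram_upper v i j = 0.
  by rewrite /gram_upper leqNgt => /negbTE ->.
have comm := tridiag_commutatorE t al be0 g0.
move: comm; set T := tridiag _ _ _; set Rm := (X in _ *m X - _).
set r := (X in _ = X *m _ + _); set e := (X in _ = _ *m X^T + _).
set F := (X in _ = _ + X) => comm.
pose x := \col_(i < t) y i.+1.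
have Tx : T *m x = th *: x.
  apply/colP => i; rewrite !mxE.
  rewrite (eq_bigr (fun l : 'I_t => T i l * y l.+1)); last by move=> l _; rewrite !mxE.
  rewrite tridiag_row_sum // -recy //; case: (ltnP i.+1 t) => // ti.
  by have -> : i.+1 = t; [apply/eqP; rewrite eqn_leq ti ltn_ord|rewrite yt mulr0].
have xT : x^T *m T = th *: x^T.
  by rewrite -[T]tridiag_sym -/T -trmx_mul Tx linearZ.
(* The quadratic form of a commutator with T vanishes at an eigenvector of T. Expanding the
   commutator then gives be_t y_t z^T v_(t+1) = - x^T F x. *)
have : (x^T *m (T *m Rm - Rm *m T) *m x) 0 0 = 0.
  rewrite mulmxBr mulmxBl !mulmxA xT -!mulmxA Tx -!scalemxAl -!scalemxAr.
  by rewrite subrr mxE.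
rewrite comm mulmxDr mulmxDl mxE !mulmxA -mulmxA mxE big_ord1.
have -> : (x^T *m r) 0 0 = dotv z (v t.+1).
  rewrite mxE zE; apply: eq_bigr => i _.
  by rewrite !mxE /gram_upper ltnS ltn_ord.
have -> : (e^T *m x) 0 0 = be t * y t.
  rewrite mxE; case: (posnP t) => t0.
    rewrite big1 => [|i _]; first by rewrite t0 be0 mul0r.
    by exfalso; have := ltn_ord i; lia.
  have tt : (t.-1 < t)%N by rewrite prednK.
  rewrite (bigD1 (Ordinal tt)) //= big1 ?addr0 => [|i]; first by rewrite !mxE /= prednK // eqxx.
  rewrite -val_eqE /= => it; rewrite !mxE; case: eqP => [ti|]; last by rewrite mul0r.
  by exfalso; lia.
have xFx : `|(x^T *m F *m x) 0 0| <= t%:R ^+ 2 * E * N.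
  have -> : (x^T *m F *m x) 0 0 = \sum_(i < t) \sum_(j < t) y i.+1 * y j.+1 * F j i.
    rewrite mxE; apply: eq_bigr => i _; rewrite !mxE mulr_suml.
    by apply: eq_bigr => j _; rewrite !mxE; ring.
  apply: (sum_mul_le_sum_sqr y (M := fun i j : 'I_t => F j i)) => // i j.
  by rewrite mxE (perturbed_lanczos_commutator_le symA pl) // (leq_trans (ltn_ord _)).
move=> xRx.
have tk2 : t%:R ^+ 2 <= k%:R ^+ 2 :> R by rewrite ler_sqr ?nnegrE // ler_nat.
have EN0 : 0 <= E * N by rewrite mulr_ge0 // ltW.
have tkE : t%:R ^+ 2 * (E * N) <= k%:R ^+ 2 * (E * N) by rewrite ler_wpM2r.
have kE0 : 0 <= k%:R ^+ 2 * E by rewrite mulr_ge0 ?sqr_ge0.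
have kEz : k%:R ^+ 2 * E * (N / 2) <= k%:R ^+ 2 * E * dotv z z by rewrite ler_wpM2l.
have zz0 : 0 < dotv z z by apply: lt_le_trans zz_ge; rewrite divr_gt0.
have := lambda_min_le_rayleigh z symA; have := rayleigh_le_lambda_max z symA.
rewrite zAz => hmax hmin.
move: yf xFx => /ler_normlP[h1 h2] /ler_normlP[h3 h4].
have kEz0 : 0 <= k%:R ^+ 2 * E * dotv z z by rewrite mulr_ge0 // ltW.
apply/andP; split; rewrite -(ler_pM2r zz0).
- lra.
- lra.
Qed.

(** Strong induction on t. If a smaller T_s has an eigenvalue within Q of th, its interval is
    widened by Q; otherwise the Rayleigh quotient bound applies. At most t widenings occur, since
    T_0 has no eigenvalue. *)
Lemma perturbed_lanczos_eigenvalue (R : realType) (n k : nat) (A : 'M[R]_n)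
    (v f : nat -> 'cV[R]_n) (al be : nat -> R) (E th : R) t :
  A^T = A -> perturbed_lanczos k A v f al be E -> (t <= k)%N ->
  eigenvalue (tridiag t al be) th ->
  lambda_min A - 8 * k%:R ^+ 2 * E * t%:R <= th
    <= lambda_max A + 8 * k%:R ^+ 2 * E * t%:R.
Proof.
move=> symA pl; set Q := 8 * k%:R ^+ 2 * E.
have E0 : 0 <= E by have := le_trans (normr_ge0 _) (pl_local pl (leq0n k)); lra.
have Q0 : 0 <= Q by rewrite !mulr_ge0 // ?sqr_ge0.
elim/ltn_ind: t th => t IH th tk eT.
have [[s [st [a [ea ath]]]]|far] := pselect (exists s, (s < t)%N /\
    exists a, eigenvalue (tridiag s al be) a /\ `|th - a| <= Q).
  have /andP[a1 a2] := IH s st a (ltnW (leq_trans st tk)) ea.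
  have : Q * (s%:R + 1) <= Q * t%:R by rewrite ler_wpM2l // natr1 ler_nat.
  by move: ath => /ler_normlP[]; rewrite mulrDr mulr1 => *; apply/andP; split; lra.
have t0 : (0 < t)%N.
  case: t eT {IH tk far} => // /eigenvalueP[w _].
  by rewrite (thinmx0 w) eqxx.
have Qt : Q <= Q * t%:R by rewrite ler_peMr // ler1n.
have : lambda_min A - Q <= th <= lambda_max A + Q.
  apply: (perturbed_lanczos_rayleigh symA pl tk eT) => s st a ea.
  by rewrite ltNge; apply/negP => ath; apply: far; exists s; split=> //; exists a.
by move=> /andP[? ?]; apply/andP; split; lra.
Qed.

(** * Rounding errors in one Lanczos iteration *)

Lemma enorm_near1 (R : realType) n (x : 'cV[R]_n) (eps : R) :
  eps <= 1 -> `|dotv x x - 1| <= eps -> 1 - eps <= enorm x <= 1 + eps.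
Proof.
move=> e1 xx; have e0 : 0 <= eps by apply: le_trans xx.
move: xx => /ler_normlP[x1 x2].
have ee : 0 <= eps * (1 - eps) by rewrite mulr_ge0 // subr_ge0.
have e2 := sqr_ge0 eps.
apply/andP; split; rewrite -ler_sqr ?nnegrE ?enorm_ge0 ?subr_ge0 ?addr_ge0 //;
  rewrite enorm_sqr; lra.
Qed.

(** The squared left side is |y|^2 - (x,y)^2 (2 - |x|^2), so x need only be roughly of unit
    length. *)
Lemma enorm_project_le (R : realType) n (x y : 'cV[R]_n) :
  dotv x x <= 2 -> enorm (y - dotv x y *: x) <= enorm y.
Proof.
move=> xx; rewrite -ler_sqr ?nnegrE ?enorm_ge0 // !enorm_sqr.
rewrite !(dotvDl, dotvDr, dotvNl, dotvNr, dotvZl, dotvZr) (dotvC y x).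
have : 0 <= dotv x y ^+ 2 * (2 - dotv x x) by rewrite mulr_ge0 ?sqr_ge0 ?subr_ge0.
lra.
Qed.

(** The last bound is local orthogonality: v^T z is the sum of v^T w (1 - |v|^2), - e |v|^2 and v^T
    ez, each of order eps |w|. *)
Lemma lanczos_orthogonalization_step (R : realType) n (v w z : 'cV[R]_n)
    (alpha eps e : R) (ez : 'cV[R]_n) :
  0 <= eps -> eps <= 1 / 20 -> `|dotv v v - 1| <= eps ->
  alpha = dotv v w + e -> `|e| <= eps * enorm v * enorm w ->
  z = w - alpha *: v + ez -> enorm ez <= eps * (enorm w + `|alpha| * enorm v) ->
  [/\ `|alpha| * enorm v <= 6 / 5 * enorm w,
      enorm z <= (1 + 4 * eps) * enorm w &
      `|dotv v z| <= 5 * eps * enorm w].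
Proof.
move=> e0 e20 vv -> ea -> eze.
have e1 : eps <= 1 by lra.
have /andP[nv1 nv2] := enorm_near1 e1 vv.
have vv' := enorm_sqr v.
move: (vv) => /ler_normlP[vv1 vv2].
have W0 := enorm_ge0 w; have V0 := enorm_ge0 v.
set W := enorm w in ea eze W0 *; set V := enorm v in ea eze nv1 nv2 V0 vv' *.
have eW0 : 0 <= eps * W by rewrite mulr_ge0.
have vw : `|dotv v w| <= V * W by exact: dotv_le_enorm.
have VW0 : 0 <= V * W by rewrite mulr_ge0.
have VVW : dotv v v * W <= 21 / 20 * W by rewrite ler_wpM2r //; lra.
have eVVW : eps * (dotv v v * W) <= eps * (21 / 20 * W) by rewrite ler_wpM2l.
have alphaE : `|dotv v w + e| * V <= (1 + eps) * (dotv v v * W).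
  rewrite -vv'; apply: (@le_trans _ _ ((V * W + eps * V * W) * V)).
    by rewrite ler_wpM2r // (le_trans (ler_normD _ _)) // lerD.
  lra.
have aV : `|dotv v w + e| * V <= 6 / 5 * W.
  apply: le_trans alphaE _.
  have : eps * (21 / 20 * W) <= 1 / 20 * (21 / 20 * W) by rewrite ler_wpM2r //; lra.
  lra.
have eaV : eps * (`|dotv v w + e| * V) <= eps * (6 / 5 * W) by rewrite ler_wpM2l.
have VeVW : `|e| * V <= 21 / 20 * (eps * W).
  apply: (@le_trans _ _ (eps * V * W * V)); first by rewrite ler_wpM2r.
  have -> : eps * V * W * V = eps * (V ^+ 2 * W) by ring.
  by rewrite vv'; lra.
split=> //.
  have -> : w - (dotv v w + e) *: v + ez = (w - dotv v w *: v) + (- e *: v + ez).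
    by rewrite scalerDl scaleNr opprD !addrA.
  apply: le_trans (enormD _ _) _.
  have := le_trans (enormD (- e *: v) ez) (lerD (lexx _) eze).
  rewrite enormZ normrN -/V.
  have : enorm (w - dotv v w *: v) <= W by apply: enorm_project_le; lra.
  lra.
rewrite dotvDr dotvDr dotvNr dotvZr.
have -> : dotv v w - (dotv v w + e) * dotv v v + dotv v ez =
   dotv v w * (1 - dotv v v) - e * dotv v v + dotv v ez by ring.
have h1 : `|dotv v w * (1 - dotv v v)| <= 21 / 20 * (eps * W).
  rewrite normrM distrC; apply: (@le_trans _ _ (V * W * eps)); first exact: ler_pM.
  rewrite -mulrA (mulrC W); rewrite ler_wpM2r //; lra.
have h2 : `|e * dotv v v| <= 5 / 4 * (eps * W).
  rewrite normrM -vv' (ger0_norm (sqr_ge0 _)) expr2 mulrA.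
  apply: (@le_trans _ _ (21 / 20 * (eps * W) * (21 / 20))).
    by rewrite ler_pM ?mulr_ge0 //; lra.
  lra.
have h3 : `|dotv v ez| <= 21 / 20 * (11 / 5 * (eps * W)).
  apply: le_trans (dotv_le_enorm _ _) _; rewrite -/V.
  apply: ler_pM; rewrite ?enorm_ge0 //; first by lra.
  by apply: le_trans eze _; lra.
apply: le_trans (ler_normD _ _) _.
apply: (@le_trans _ _ (`|dotv v w * (1 - dotv v v)| + `|e * dotv v v| + `|dotv v ez|)).
  by rewrite lerD2r ler_normB.
lra.
Qed.

(** Here [vp], [v], [vn] are v_(j-1), v_j, v_(j+1) and [bp], [b] are beta_(j-1), beta_j. The lengths
    of [vp] and [vn] enter only multiplied by [bp] and [b], which covers v_0 = 0 and a terminated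
    run, where v_(k+1) is arbitrary. *)
Lemma lanczos_step_bounds (R : realType) n (A : 'M[R]_n)
    (vp v vn u w z eu ew ez D : 'cV[R]_n) (alpha bp b eps e : R) :
  let a := spectral_norm A in let W := enorm w in
  0 <= eps -> eps <= 1 / 20 -> 0 <= bp -> 0 <= b ->
  `|dotv v v - 1| <= eps ->
  bp * enorm vp <= (1 + eps) * bp -> (1 - eps) * b <= b * enorm vn ->
  u = A *m v + eu -> enorm eu <= eps * a * enorm v ->
  w = u - bp *: vp + ew -> enorm ew <= eps * (enorm u + bp * enorm vp) ->
  alpha = dotv v w + e -> `|e| <= eps * enorm v * W ->
  z = w - alpha *: v + ez -> enorm ez <= eps * (W + `|alpha| * enorm v) ->
  b *: vn = z + D -> enorm D <= eps * enorm z ->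
  [/\ W <= (1 + eps) ^+ 2 * ((1 + eps) * a + bp),
      b <= (1 + 38 / 5 * eps) * W,
      `|b * dotv v vn| <= 63 / 10 * eps * W &
      enorm (A *m v - bp *: vp - alpha *: v - b *: vn) <=
        eps * ((1 + eps) * a + (1 + eps) * ((1 + eps) * a + bp) + 17 / 5 * W)].
Proof.
move=> a W e0 e20 bp0 b0 vv bvp bvn uE eue wE ewe aE ee zE eze bE De.
have e1 : eps <= 1 by lra.
have /andP[nv1 nv2] := enorm_near1 e1 vv.
have [aV zW vz] := lanczos_orthogonalization_step e0 e20 vv aE ee zE eze.
rewrite -/W in aV zW vz.
have W0 : 0 <= W := enorm_ge0 w; have a0 : 0 <= a := spectral_norm_ge0 A.
have eW0 : 0 <= eps * W by rewrite mulr_ge0.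
have eW : eps * W <= 1 / 20 * W by rewrite ler_wpM2r.
have eeW : eps * (eps * W) <= 1 / 20 * (eps * W) by rewrite ler_wpM2r.
have eplus0 : 0 <= 1 + eps by lra.
have euA : enorm eu <= eps * ((1 + eps) * a).
  by apply: le_trans eue _; rewrite -mulrA ler_wpM2l // mulrC ler_wpM2r.
have uA : enorm u <= (1 + eps) ^+ 2 * a.
  rewrite uE; apply: le_trans (enormD _ _) _.
  have : enorm (A *m v) <= (1 + eps) * a.
    by apply: le_trans (enorm_mulmx_le _ _) _; rewrite mulrC ler_wpM2r.
  lra.
pose s := (1 + eps) * ((1 + eps) * a + bp).
have us : enorm u + bp * enorm vp <= s by rewrite /s; lra.
have ews : enorm ew <= eps * s by apply: le_trans ewe _; rewrite ler_wpM2l.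
have Ws : W <= (1 + eps) * s.
  rewrite /W wE; apply: le_trans (enormD _ _) _.
  have := enormD u (- (bp *: vp)); rewrite enormN enormZ (ger0_norm bp0); lra.
have ezW : enorm ez <= eps * (11 / 5 * W).
  by apply: le_trans eze _; rewrite ler_wpM2l //; lra.
have De' : enorm D <= eps * (6 / 5 * W).
  apply: le_trans De _; rewrite ler_wpM2l //; lra.
split.
- by move: Ws; rewrite /s mulrA -expr2.
- have bn : (1 - eps) * b <= (1 + eps) * ((1 + 4 * eps) * W).
    apply: le_trans bvn _; rewrite -[b in b * _]ger0_norm // -enormZ bE.
    apply: le_trans (enormD _ _) _.
    have : (1 + eps) * enorm z <= (1 + eps) * ((1 + 4 * eps) * W) by rewrite ler_wpM2l.
    lra.
  have em : 0 < 1 - eps by lra.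
  rewrite -(ler_pM2l em); apply: le_trans bn _.
  rewrite !mulrA ler_wpM2r //.
  have ee0 : 0 <= eps * (1 / 20 - eps) by rewrite mulr_ge0 // subr_ge0.
  lra.
- rewrite -dotvZr bE dotvDr; apply: le_trans (ler_normD _ _) _.
  have : `|dotv v D| <= 21 / 20 * (eps * (6 / 5 * W)).
    apply: le_trans (dotv_le_enorm _ _) _; apply: ler_pM; rewrite ?enorm_ge0 //; lra.
  lra.
(* The residual of the recurrence is exactly the sum of the four rounding errors, up to sign. *)
- have -> : A *m v - bp *: vp - alpha *: v - b *: vn = - (eu + ew + (ez + D)).
    rewrite bE zE wE uE !opprD !addrA; apply/colP => i; rewrite !mxE; ring.
  rewrite enormN; have := enormD (eu + ew) (ez + D).
  have := enormD eu ew; have := enormD ez D; rewrite -/s; lra.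
Qed.

(** * Growth of the coefficients and reduction of a run to a perturbed recurrence *)

(** Induction step for beta_m <= m a / (1 - 12 eps m). Powers of 1 + 12 eps are avoided by (1 - 12
    eps (m + 1)) (1 + 12 eps) <= 1 - 12 eps m. *)
Lemma lanczos_growth (R : realType) (a b bp W eps m : R) :
  0 <= eps -> eps <= 1 / 20 -> 0 <= a -> 0 <= bp -> 0 <= m ->
  12 * eps * (m + 1) <= 1 ->
  W <= (1 + eps) ^+ 2 * ((1 + eps) * a + bp) -> b <= (1 + 38 / 5 * eps) * W ->
  (1 - 12 * eps * m) * bp <= m * a ->
  (1 - 12 * eps * (m + 1)) * b <= (m + 1) * a.
Proof.
move=> e0 e20 a0 bp0 m0 em Wle ble IH.
have ab0 : 0 <= a + bp by rewrite addr_ge0.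
have ee : eps * eps <= 1 / 20 * eps by rewrite ler_wpM2r.
have h1 : (1 + eps) ^+ 2 * ((1 + eps) * a + bp) <= (1 + 79 / 25 * eps) * (a + bp).
  have e2 : (1 + eps) ^+ 2 <= 1 + 79 / 25 * eps by lra.
  have e3 : (1 + eps) ^+ 2 * (1 + eps) <= 1 + 79 / 25 * eps.
    have : eps * (eps * eps) <= eps * (1 / 20 * eps) by rewrite ler_wpM2l.
    lra.
  by rewrite !mulrDr mulrA lerD // ler_wpM2r.
(* For eps <= 1/20, 38/5 + 79/25 and the quadratic term together stay below 12. *)
have h2 : b <= (1 + 12 * eps) * (a + bp).
  apply: le_trans ble _.
  apply: (@le_trans _ _ ((1 + 38 / 5 * eps) * ((1 + 79 / 25 * eps) * (a + bp)))).
    by rewrite ler_wpM2l ?(le_trans Wle) //; lra.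
  by rewrite mulrA ler_wpM2r //; lra.
have em0 : 0 <= 1 - 12 * eps * (m + 1) by lra.
apply: (@le_trans _ _ ((1 - 12 * eps * (m + 1)) * ((1 + 12 * eps) * (a + bp)))).
  by rewrite ler_wpM2l.
have : (1 - 12 * eps * (m + 1)) * (1 + 12 * eps) * (a + bp)
    <= (1 - 12 * eps * m) * (a + bp).
  rewrite ler_wpM2r //.
  have : 0 <= eps * eps * (m + 1) by rewrite !mulr_ge0 ?addr_ge0.
  lra.
have : 0 <= eps * m * a by rewrite !mulr_ge0.
rewrite mulrA; lra.
Qed.

Lemma lanczos_run_perturbed (R : realType) (n k : nat) (A : 'M[R]_n)
    (b : 'cV[R]_n) (eps : R) (v u w z : nat -> 'cV[R]_n) (alpha beta : nat -> R) :
  (0 < k)%N -> 0 <= eps -> eps * k%:R <= 1 / 20 ->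
  lanczos_run A b eps k v u w z alpha beta ->
  exists f, perturbed_lanczos k A v f alpha beta
    (60 * (eps * (k%:R * spectral_norm A))).
Proof.
move=> k0 e0 ek run; set a := spectral_norm A.
have k1 : 1 <= k%:R :> R by rewrite ler1n.
have e20 : eps <= 1 / 20 by apply: le_trans ek; rewrite ler_peMr.
have e1 : eps <= 1 by lra.
have a0 : 0 <= a := spectral_norm_ge0 A.
have be0 := run_beta0 run.
have vnorm j : (j < k)%N -> `|dotv (v j.+1) (v j.+1) - 1| <= eps.
  case: j => [_|j jk]; first exact: run_v1_unit run.
  have [||_ _ //] := run_next run (j := j.+1); first exact: ltnW.
  exact: (run_no_early_stop run).
have next j : (j < k)%N -> [/\ 0 <= beta j.+1,
    (1 - eps) * beta j.+1 <= beta j.+1 * enorm (v j.+2) &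
    exists2 D, beta j.+1 *: v j.+2 = z j.+1 + D & enorm D <= eps * enorm (z j.+1)].
  move=> jk; have jk' : (1 <= j.+1 <= k)%N by [].
  (* On termination [beta j.+1] is 0, and D = 0 works whatever [v j.+2] is. *)
  have [z0|z0] := eqVneq (z j.+1) 0.
    rewrite (run_stop run jk' z0) z0 mulr0 mul0r; split=> //; exists 0.
      by rewrite scale0r addr0.
    by rewrite enorm0 mulr0.
  have [bpos ex vv] := run_next run jk' z0; split=> //; first exact: ltW.
  rewrite mulrC ler_wpM2l ?(ltW bpos) //.
  by have /andP[] := enorm_near1 e1 vv.
have beta_ge0 j : (j <= k)%N -> 0 <= beta j.
  by case: j => [|j] jk; rewrite ?be0 //; case: (next j jk).
have beta_v j : (j <= k)%N -> beta j * enorm (v j) <= (1 + eps) * beta j.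
  case: j => [|j] jk; first by rewrite be0 mul0r mulr0.
  rewrite mulrC ler_wpM2r ?beta_ge0 //.
  by have /andP[] := enorm_near1 e1 (vnorm _ jk).
have step j : (j < k)%N -> let W := enorm (w j.+1) in
  [/\ W <= (1 + eps) ^+ 2 * ((1 + eps) * a + beta j),
      beta j.+1 <= (1 + 38 / 5 * eps) * W,
      `|beta j.+1 * dotv (v j.+1) (v j.+2)| <= 63 / 10 * eps * W &
      enorm (A *m v j.+1 - beta j *: v j - alpha j.+1 *: v j.+1 - beta j.+1 *: v j.+2) <=
        eps * ((1 + eps) * a + (1 + eps) * ((1 + eps) * a + beta j) + 17 / 5 * W)].
  move=> jk; have jk' : (1 <= j.+1 <= k)%N by [].
  have [b0 bv [D zD De]] := next j jk.
  have [eu uE eue] := run_u run jk'; have [ew wE ewe] := run_w run jk'.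
  have [e aE ee] := run_alpha run jk'; have [ez zE eze] := run_z run jk'.
  exact: (lanczos_step_bounds e0 e20 (beta_ge0 j (ltnW jk)) b0 (vnorm j jk)
    (beta_v j (ltnW jk)) bv uE eue wE ewe aE ee zE eze zD De).
have le_k j : (j <= k)%N -> j%:R <= k%:R :> R by rewrite ler_nat.
have ej j : (j <= k)%N -> eps * j%:R <= 1 / 20.
  by move=> jk; apply: le_trans ek; rewrite ler_wpM2l ?le_k.
have beta_growth j : (j <= k)%N -> (1 - 12 * eps * j%:R) * beta j <= j%:R * a.
  elim: j => [_|j IH jk]; first by rewrite be0 mulr0 mul0r.
  have [h1 h2 _ _] := step j jk; rewrite -(natr1 j).
  apply: (lanczos_growth e0 e20 a0 (beta_ge0 j (ltnW jk)) _ _ h1 h2 (IH (ltnW jk))) => //.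
  by have := ej _ jk; rewrite natr1; lra.
pose K := k%:R * a; have aK : a <= K by rewrite ler_peMl.
(* Since 12 eps j <= 3/5, the factor 1 - 12 eps j is at least 2/5. *)
have betaK j : (j <= k)%N -> beta j <= 5 / 2 * K.
  move=> jk; have := beta_growth j jk; have b0 := beta_ge0 j jk.
  have : eps * j%:R * beta j <= 1 / 20 * beta j by rewrite ler_wpM2r // ej.
  have : j%:R * a <= K by rewrite ler_wpM2r // le_k.
  lra.
have K0 : 0 <= K by apply: le_trans aK.
have eaK : (1 + eps) * a <= 21 / 20 * K by apply: ler_pM => //; lra.
have WK j : (j < k)%N -> enorm (w j.+1) <= 4 * K.
  move=> jk; have [h1 _ _ _] := step j jk; have bK := betaK j (ltnW jk).
  have b0 := beta_ge0 j (ltnW jk); apply: le_trans h1 _.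
  apply: (@le_trans _ _ ((21 / 20) ^+ 2 * (21 / 20 * K + 5 / 2 * K))); last by lra.
  apply: ler_pM; rewrite ?sqr_ge0 ?addr_ge0 ?mulr_ge0 ?addr_ge0 //; last by lra.
  by rewrite ler_sqr ?nnegrE ?addr_ge0 //; lra.
(* Taking f to be the residual makes the recurrence hold by definition; only its size needs
   proof. *)
pose f j := A *m v j - beta j.-1 *: v j.-1 - alpha j *: v j - beta j *: v j.+1.
have fK j : (j < k)%N -> enorm (f j.+1) <= eps * (37 / 2 * K).
  move=> jk; have [_ _ _ h4] := step j jk; apply: le_trans h4 _.
  rewrite ler_wpM2l //.
  have : (1 + eps) * ((1 + eps) * a + beta j) <= 21 / 20 * (21 / 20 * K + 5 / 2 * K).
    apply: ler_pM; rewrite ?addr_ge0 ?mulr_ge0 ?addr_ge0 ?beta_ge0 1?ltnW //; first by lra.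
    by have := betaK j (ltnW jk); lra.
  by have := WK j jk; lra.
have eK0 : 0 <= eps * K by rewrite mulr_ge0.
(* In units of eps K, E is 60, and the bounds below need 19.425 <= 24 for the errors, 25.2 <= 30 for
   local orthogonality and 5 <= 12 for the lengths. *)
exists f; split=> //.
- by move=> j jk; rewrite /f /=; apply/colP => i; rewrite !mxE; ring.
- by move=> j jk; have /ler_normlP[] := vnorm j jk; lra.
- move=> i j ik jk; apply: le_trans (dotv_le_enorm _ _) _.
  apply: (@le_trans _ _ (21 / 20 * (eps * (37 / 2 * K)))); last by rewrite -/K; lra.
  apply: ler_pM; rewrite ?enorm_ge0 ?fK //.
  by have /andP[_ ?] := enorm_near1 e1 (vnorm _ ik); lra.
- case=> [_|j jk]; first by rewrite be0 mul0r normr0 -/K; lra.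
  have [_ _ h3 _] := step j jk; apply: le_trans h3 _.
  have : eps * enorm (w j.+1) <= eps * (4 * K) by rewrite ler_wpM2l ?WK.
  by rewrite -/K; lra.
- move=> j jk; have jk' := ltnW jk; rewrite normrM (ger0_norm (beta_ge0 _ jk')).
  apply: (@le_trans _ _ (5 / 2 * K * (2 * eps))); last by rewrite -/K; lra.
  apply: ler_pM; rewrite ?beta_ge0 ?betaK // ler_norml.
  have /ler_normlP[] := vnorm _ jk; have /ler_normlP[] := vnorm _ jk'.
  by move=> *; apply/andP; split; lra.
Qed.

(** * Distance to the spectral interval and the final bound *)

Lemma edist_inf_itv_le (R : realType) (l r x q : R) :
  l <= r -> l - q <= x <= r + q -> 0 <= q -> (edist_inf `[l, r] x <= q%:E)%E.
Proof.
move=> lr /andP[x1 x2] q0.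
(* p is the point of the interval nearest to x. *)
pose p := Num.max l (Num.min x r).
have pI : p \in `[l, r] by rewrite in_itv /= le_max lexx /= ge_max lr /= ge_min lexx orbT.
have px : `|x - p| <= q.
  rewrite /p ler_norml; case: (leP x r) => xr; case: (leP l _) => lx;
    apply/andP; split; lra.
apply: ge_ereal_inf; exists (edist (x, p)); first by exists p.
(* [edist] is bounded through open balls, so the radius q is first enlarged by an arbitrary e >
   0. *)
apply/lee_addgt0Pr => e e0; rewrite -EFinD; apply: edist_fin.
  by rewrite ltr_wpDl.
by rewrite -ball_normE /=; apply: le_lt_trans px _; rewrite ltrDl.
Qed.

Theorem theorem3p7 (R : realType) :
  exists c d : R, [/\ 0 < c, 0 < d &
    forall (n kmax k : nat) (A : 'M[R]_n) (b : 'cV[R]_n) (eps : R)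
           (v u w z : nat -> 'cV[R]_n) (alpha beta : nat -> R),
      (1 <= n)%N -> (1 <= kmax)%N -> (1 <= k <= kmax)%N ->
      A^T = A -> b != 0 ->
      0 <= eps -> eps <= 1 / (20%:R * kmax%:R) ->
      lanczos_run A b eps k v u w z alpha beta ->
      forall theta : R, eigenvalue (tridiag k alpha beta) theta ->
        (edist_inf `[lambda_min A, lambda_max A] theta
           <= (c * (k%:R `^ d) * eps * spectral_norm A)%:E)%E].
Proof.
(* 480 is 8 times 60. Of the four powers of k, two come from the separation 8 k^2 E, one from E,
   which is proportional to k, and one from the induction on t. *)
exists 480, 4; split=> // n kmax k A b eps v u w z alpha beta n0 kmax0
  /andP[k0 kkmax] symA _ e0 ekmax run th eT.
have ek : eps * k%:R <= 1 / 20.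
  apply: (@le_trans _ _ (eps * kmax%:R)); first by rewrite ler_wpM2l // ler_nat.
  have kmax_gt0 : 0 < kmax%:R :> R by rewrite ltr0n.
  by move: ekmax; rewrite ler_pdivlMr ?mulr_gt0 //; lra.
have [f pl] := lanczos_run_perturbed k0 e0 ek run.
have thI := perturbed_lanczos_eigenvalue symA pl (leqnn k) eT.
apply: edist_inf_itv_le; first exact: lambda_min_le_max.
  rewrite (powR_mulrn 4) ?ler0n //.
  have -> : 480 * k%:R ^+ 4 * eps * spectral_norm A =
    8 * k%:R ^+ 2 * (60 * (eps * (k%:R * spectral_norm A))) * k%:R by ring.
  exact: thI.
by rewrite !mulr_ge0 ?powR_ge0 ?spectral_norm_ge0.
Qed.
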